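(* Let $S$ be a semilattice-ordered semigroup and let $X=\mathcal{P}(S)$ with the hull-kernel topology, and let $A\star B=AB=\{ab\mid a\in A,b\in B\}$ for $A,B\in X$. (1) For a subset $B\subseteq S$, the right translation $R_B:X\to X$, $R_B(A)=A\star B$, is spectral if and only if $\mathrm{LFac}_B(s)$ is finite for every $s\in S$. (2) For a subset $A\subseteq S$, the left translation $L_A:X\to X$, $L_A(B)=A\star B$, is spectral if and only if $\mathrm{RFac}_A(s)$ is finite for every $s\in S$.
   Context: A semilattice-ordered semigroup is a triple $(S,\cdot,\lor)$ with $S$ nonempty, $(S,\cdot)$ a semigroup, $(S,\lor)$ a semilattice (commutative, associative, idempotent), and $x(y\lor z)=xy\lor xz$, $(x\lor y)z=xz\lor yz$ for all $x,y,z\in S$. $\mathcal{P}(S)$ is the power set of $S$. The hull-kernel topology on $\mathcal{P}(S)$ has open subbasis $D(F)=\{A\in\mathcal{P}(S)\mid F\nsubseteq A\}$, $F$ ranging over finite subsets of $S$; with it $\mathcal{P}(S)$ is a spectral space (quasi-compact, $T_0$, sober, with quasi-compact opens closed under finite intersections and forming a basis). A map between spectral spaces is spectral if the preimage of every quasi-compact open set is quasi-compact and open. For $A,B\subseteq S$ and $s\in S$: $\mathrm{LFac}_B(s)=\{a\in S\mid\exists b\in B\text{ such that }ab=s\}$ and $\mathrm{RFac}_A(s)=\{b\in S\mid\exists a\in A\text{ such that }ab=s\}$. *)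

(* Defs.v *)
From HB Require Import structures.
From mathcomp Require Import all_boot all_order.
From mathcomp Require Import boolp classical_sets cardinality topology.

Set Implicit Arguments.
Unset Strict Implicit.
Unset Printing Implicit Defensive.

Local Open Scope classical_set_scope.

(* Semigroup: associative [*%g], no unit. JoinSemilattice: the library presents
   the semilattice operation [Order.join] together with its order, determined
   by [x <= y] iff [x `|` y = y]. *)
HB.mixin Record isSemilatticeOrderedSemigroup d S
    of Semigroup S & Order.JoinSemilattice d S := {
  mulg_joinr : right_distributive (@mul S) (@Order.join d S);
  mulg_joinl : left_distributive (@mul S) (@Order.join d S);
  slo_inhabited : inhabited S
}.

#[short(type="slosemigroupType")]
HB.structure Definition SemilatticeOrderedSemigroup d :=
  { S of Semigroup S & Order.JoinSemilattice d S
       & isSemilatticeOrderedSemigroup d S }.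

(* The alias separates the hull-kernel topology from any other topology that
   could be inferred on [set S = S -> Prop]. *)
Definition hull_kernel (S : Type) : Type := set S.

HB.instance Definition _ (S : Type) := Pointed.copy (hull_kernel S) (set S).

Definition hull_kernel_subbase (S : Type) (F : set S) : set (hull_kernel S) :=
  [set A | ~ (F `<=` A)].

HB.instance Definition _ (S : Type) :=
  @isSubBaseTopological.Build (hull_kernel S)
    (set S) (@finite_set S) (@hull_kernel_subbase S).

(* [compact] is quasi-compactness: it involves no separation axiom. *)
Definition spectral_map (X Y : topologicalType) (f : X -> Y) :=
  forall U : set Y, open U -> compact U ->
    open (f @^-1` U) /\ compact (f @^-1` U).

Section Products.
Variables (d : Order.disp_t) (S : slosemigroupType d).

Definition star (A B : hull_kernel S) : hull_kernel S :=
  [set (a * b)%g | a in A & b in B].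

Definition right_translation (B A : hull_kernel S) : hull_kernel S := star A B.

Definition left_translation (A B : hull_kernel S) : hull_kernel S := star A B.

Definition LFac (B : set S) (s : S) : set S :=
  [set a | exists2 b, B b & (a * b)%g = s].

Definition RFac (A : set S) (s : S) : set S :=
  [set b | exists2 a, A a & (a * b)%g = s].

End Products.

(* Main.v *)
Require Import Defs.
From mathcomp Require Import all_boot all_order.
From mathcomp Require Import finmap.
From mathcomp Require Import boolp classical_sets cardinality topology.

(** Both translations are instances of one construction: given a family [L] of
    subsets of [S] indexed by [T], send [A] to the set [f A] of those [s] for
    which [L s] meets [A].  Right translation by [B] is the case [L = LFac B],
    left translation by [A] the case [L = RFac A].

    The quasi-compact open sets [avoid F] (the sets disjoint from [F], for [F]
    finite) form a basis of the hull-kernel topology, and the preimage of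
    [avoid [set s]] under [f] is [avoid (L s)].  The set [avoid E] has a largest
    element [~` E], and a basic neighbourhood of [~` E] that lies inside
    [avoid E] is [avoid G] with [G] finite and equal to [E]; hence [avoid E] is
    open only if [E] is finite ([finite_open_avoid]).  This proves that all
    [L s] are finite when [f] is spectral.

    Conversely, if all [L s] are finite then [f] is continuous, because the
    preimage of [avoid G] is [avoid (\bigcup_(s in G) L s)].  It remains to see
    that preimages of quasi-compact opens are quasi-compact, and this holds for
    every [L] ([compact_preimage_meets]): [f] preserves unions, so it has a right
    adjoint [g], and [g] turns a cluster point of the pushforward of a filter
    into a cluster point of the filter itself. *)

Set Implicit Arguments.
Unset Strict Implicit.
Unset Printing Implicit Defensive.

Local Open Scope classical_set_scope.

Definition avoid (S : Type) (F : set S) : set (hull_kernel S) :=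
  [set A | A `<=` ~` F].

Lemma open_hull_kernelE (S : Type) (U : set (hull_kernel S)) :
  open U = exists2 E,
    E `<=` finI_from finite_set (@hull_kernel_subbase S) &
    \bigcup_(V in E) V = U.
Proof. by []. Qed.

Lemma nbhs_notin (S : Type) (C : hull_kernel S) (s : S) :
  ~ C s -> nbhs C [set A : hull_kernel S | ~ A s].
Proof.
move=> nCs; apply: (@filterS _ _ _ (hull_kernel_subbase [set s])).
  by move=> A sA As; apply: sA => _ ->.
apply: open_nbhs_nbhs; split; last by move=> sC; exact/nCs/sC.
rewrite open_hull_kernelE.
exists [set hull_kernel_subbase [set s]]; last by rewrite bigcup_set1.
by move=> _ ->; apply: finI_from1; exact: finite_set1.
Qed.

Lemma open_avoid (S : choiceType) (F : set S) :
  finite_set F -> open (avoid F).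
Proof.
move=> /finite_fsetP[D ->]; rewrite openE => C CF; rewrite /interior.
apply: (@filterS _ (nbhs C) _ (\bigcap_(s in [set` D]) [set A : hull_kernel S | ~ A s])).
  by move=> A AD s As Ds; exact: AD As.
by apply: filter_bigI => s Ds; apply: nbhs_notin => Cs; exact: CF Ds.
Qed.

(** A point [C] of a finite intersection of subbasic sets [F i] not included in
    [C] misses a point of each [F i]; the union of the sets [F i `\` C] is then
    a finite set, disjoint from [C], that meets every [F i]. *)
Lemma open_avoid_basis (S : Type) (U : set (hull_kernel S)) (C : hull_kernel S) :
  open U -> U C -> exists F, [/\ finite_set F, avoid F C & avoid F `<=` U].
Proof.
rewrite open_hull_kernelE => -[E sE <-] [V EV VC].
have [D Dfin eV] := sE V EV.
exists (\bigcup_(K in [set` D]) (K `\` C)); split.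
- apply: bigcup_finite; first exact: finite_fset.
  move=> K /= KD; apply: sub_finite_set (@subDsetl _ _ _) _.
  by have := Dfin K KD; rewrite inE.
- by move=> s Cs [K _ [_]].
- move=> A AF; exists V => //; rewrite -eV => K KD KA.
  have : ~ K `<=` C by move: VC; rewrite -eV; exact.
  by apply=> s Ks; apply: contrapT => nCs; apply: (AF s (KA s Ks)); exists K.
Qed.

Lemma open_downward (S : Type) (U : set (hull_kernel S)) (B C : hull_kernel S) :
  open U -> B `<=` C -> U C -> U B.
Proof.
move=> oU BC UC; have [F [_ CF FU]] := open_avoid_basis oU UC.
exact: (FU B (subset_trans BC CF)).
Qed.

(** Every filter on [avoid F] clusters at the largest element [~` F], because an
    open set around [~` F] contains all of [avoid F]. *)
Lemma compact_avoid (S : Type) (F : set S) : compact (avoid F).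
Proof.
move=> G PG GF; exists (~` F); split; first exact: subset_refl.
move=> P V GP; rewrite nbhsE => -[W [oW WF] WV].
have [A [PA AF]] := filter_ex (filterI GP GF).
by exists A; split=> //; exact/WV/(open_downward oW AF WF).
Qed.

(** A basic neighbourhood [avoid G] of [~` F] has [G `<=` F]; if it lies inside
    [avoid F], its element [~` G] gives [F `<=` G]. *)
Lemma finite_open_avoid (S : Type) (F : set S) :
  open (avoid F) -> finite_set F.
Proof.
move=> oF; have FF : avoid F (~` F) by exact: subset_refl.
have [G [finG _ GF]] := open_avoid_basis oF FF.
apply: sub_finite_set finG => s Fs; apply: contrapT => nGs.
have GcF : avoid F (~` G) by apply: GF; exact: subset_refl.
exact: (GcF s nGs).
Qed.

Definition meets (S T : Type) (L : T -> set S) (A : hull_kernel S) :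
    hull_kernel T :=
  [set s | L s `&` A !=set0].

Lemma meets_avoid (S T : Type) (L : T -> set S) (F : set T)
    (A : hull_kernel S) :
  avoid F (meets L A) <-> avoid (\bigcup_(s in F) L s) A.
Proof.
split=> [AF a Aa [s Fs La]|AF s [a [La Aa]] Fs].
  by apply: (AF s _ Fs); exists a.
by apply: (AF a Aa); exists s.
Qed.

Lemma open_preimage_meets (S : choiceType) (T : Type) (L : T -> set S)
    (U : set (hull_kernel T)) :
  (forall s, finite_set (L s)) -> open U -> open (meets L @^-1` U).
Proof.
move=> finL oU; rewrite openE => A UA; rewrite /interior.
have [F [finF AF FU]] := open_avoid_basis oU UA.
apply: (@filterS _ (nbhs A) _ (avoid (\bigcup_(s in F) L s))).
  by move=> B BF; apply/FU/meets_avoid.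
apply: open_nbhs_nbhs; split; last exact/meets_avoid.
by apply: open_avoid; exact: bigcup_finite.
Qed.

(** Let [C] in [U] be a cluster point of the pushforward of a filter [F].  The
    largest set [K] with [meets L K `<=` C] is a cluster point of [F] in the
    preimage: each [h] in a finite set disjoint from [K] lies in some [L s] with
    [s] not in [C], and [A] cannot contain [h] when [meets L A] omits [s]. *)
Lemma compact_preimage_meets (S : choiceType) (T : Type) (L : T -> set S)
    (U : set (hull_kernel T)) :
  open U -> compact U -> compact (meets L @^-1` U).
Proof.
move=> oU cU F PF FU.
have [C [UC clC]] := cU (meets L @ F) _ FU.
pose K : hull_kernel S := [set a | forall s, L s a -> C s].
exists K; split.
  by apply: (open_downward oU _ UC) => s [a [La Ka]]; exact: Ka.
move=> P V FP; rewrite nbhsE => -[W [oW WK] WV].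
have [H [/finite_fsetP[D ->] KD DW]] := open_avoid_basis oW WK.
pose Q (h : S) : set (hull_kernel T) := [set B | exists2 s, L s h & ~ B s].
have nQ : nbhs C (\bigcap_(h in [set` D]) Q h).
  apply: filter_bigI => h Dh.
  have [s Lsh nCs] : exists2 s, L s h & ~ C s.
    apply: contrapT => noS; apply: (KD h) => // s Lsh.
    by apply: contrapT => nCs; apply: noS; exists s.
  apply: (@filterS _ (nbhs C) _ [set B : hull_kernel T | ~ B s]).
    by move=> B nBs; exists s.
  exact: nbhs_notin.
have FPi : F (meets L @^-1` (meets L @` P)).
  by apply: filterS FP => A PA; exists A.
have [_ [[A PA <-] QA]] := clC (meets L @` P) _ FPi nQ.
exists A; split=> //; apply/WV/DW => h Ah Dh.
by have [s Lsh] := QA h Dh; apply; exists h.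
Qed.

Lemma spectral_meetsP (S T : choiceType) (L : T -> set S) :
  spectral_map (meets L) <-> forall s, finite_set (L s).
Proof.
split=> [spL s|finL U oU cU]; last first.
  by split; [exact: open_preimage_meets|exact: compact_preimage_meets].
have [] := spL _ (open_avoid (finite_set1 s)) (@compact_avoid _ [set s]).
have -> : meets L @^-1` avoid [set s] = avoid (L s).
  by apply/predeqP => A /=; rewrite -(bigcup_set1 L s); exact: meets_avoid.
by move=> /finite_open_avoid.
Qed.

Theorem proposition4p20 (d : Order.disp_t) (S : slosemigroupType d) :
  (forall B : set S,
     spectral_map (right_translation B) <->
     (forall s : S, finite_set (LFac B s))) /\
  (forall A : set S,
     spectral_map (left_translation A) <->
     (forall s : S, finite_set (RFac A s))).
Proof.
split=> [B|A]; rewrite -spectral_meetsP.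
  suff -> : right_translation B = meets (LFac B) by [].
  apply/funext => A; apply/predeqP => s; split=> [[a Aa [b Bb ab]]|].
    by exists a; split=> //; exists b.
  by move=> [a [[b Bb ab] Aa]]; exists a => //; exists b.
suff -> : left_translation A = meets (RFac A) by [].
apply/funext => B; apply/predeqP => s; split=> [[a Aa [b Bb ab]]|].
  by exists b; split=> //; exists a.
by move=> [b [[a Aa ab] Bb]]; exists a => //; exists b.
Qed.
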